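(* Let $H$ be a weighted hypergraph with vertices $v_1,\dots,v_n$ (weights $w_j>0$) and hyperedges $e_1,\dots,e_m$ (weights $u_i>0$), in which every vertex belongs to the support of some hyperedge and every hyperedge has non-empty support. Then $$\max_{H'\subset H}\alpha(H')=\min_{A\in\mathcal S(H)} s_{\max}(A),$$ where the maximum is over all subgraphs $H'=(V',E')$ of $H$ with $V'\neq\emptyset$.
   Context: A weighted hypergraph $H=(V,E,\mathrm{supp})$ has a finite vertex set $V=\{v_1,\dots,v_n\}$, a finite hyperedge set $E=\{e_1,\dots,e_m\}$, a support map $\mathrm{supp}:E\to\mathcal P(V)$, and positive weights $\mathrm{wt}(v_j)=w_j$, $\mathrm{wt}(e_i)=u_i$. For $V'\subset V$, $E'\subset E$ put $\mathrm{wt}(V')=\sum_{v\in V'}\mathrm{wt}(v)$, $\mathrm{wt}(E')=\sum_{e\in E'}\mathrm{wt}(e)$. A subgraph of $H$ is a pair $H'=(V',E')$ with $V'\subset V$, $E'\subset E$ and $\mathrm{supp}(e)\subset V'$ for every $e\in E'$. Its density is $\alpha(H')=\mathrm{wt}(E')/\mathrm{wt}(V')$. A support matrix of $H$ is a real $m\times n$ matrix $A=(a_{ij})$ with $a_{ij}\ge 0$, $a_{ij}=0$ whenever $v_j\notin\mathrm{supp}(e_i)$, and $\sum_{j=1}^n w_j a_{ij}=u_i$ for all $i$. $\mathcal S(H)$ denotes the set of support matrices of $H$. For $A\in\mathcal S(H)$, $s_j(A)=\sum_{i=1}^m a_{ij}$ is the $j$-th column sum and $s_{\max}(A)=\max_{1\le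 j\le n}s_j(A)$. *)

(* Defs.v *)
From HB Require Import structures.
From mathcomp Require Import all_boot all_order all_algebra.
From mathcomp Require Import classical_sets reals.

Set Implicit Arguments.
Unset Strict Implicit.
Unset Printing Implicit Defensive.

Import Order.TTheory GRing.Theory Num.Theory.
Local Open Scope ring_scope.

(* [supp] need not be injective, so distinct hyperedges may share a support. *)
Record hypergraph (R : realType) (m n : nat) := Hypergraph {
  supp : 'I_m -> {set 'I_n};
  vwt : 'I_n -> R;
  ewt : 'I_m -> R;
  vwt_gt0 : forall j, 0 < vwt j;
  ewt_gt0 : forall i, 0 < ewt i }.

Definition wtV (R : realType) (m n : nat) (H : hypergraph R m n)
  (V' : {set 'I_n}) : R := \sum_(j in V') vwt H j.

Definition wtE (R : realType) (m n : nat) (H : hypergraph R m n)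
  (E' : {set 'I_m}) : R := \sum_(i in E') ewt H i.

Record subgraph (R : realType) (m n : nat) (H : hypergraph R m n) := Subgraph {
  sub_vertices : {set 'I_n};
  sub_edges : {set 'I_m};
  sub_supp : forall i, i \in sub_edges -> supp H i \subset sub_vertices }.

Definition density (R : realType) (m n : nat) (H : hypergraph R m n)
  (H' : subgraph H) : R := wtE H (sub_edges H') / wtV H (sub_vertices H').

Definition support_matrix (R : realType) (m n : nat) (H : hypergraph R m n)
  (A : 'M[R]_(m, n)) : Prop :=
  [/\ forall i j, 0 <= A i j,
      forall i j, j \notin supp H i -> A i j = 0
    & forall i, \sum_(j < n) vwt H j * A i j = ewt H i].

Definition col_sum (R : realType) (m n : nat) (A : 'M[R]_(m, n)) (j : 'I_n) : R :=
  \sum_(i < m) A i j.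

(* The base value is itself one of the column sums, so this is exactly their
   maximum, with no artificial default. *)
Definition s_max (R : realType) (m n : nat) (A : 'M[R]_(m, n.+1)) : R :=
  \big[Num.max/col_sum A ord0]_(j < n.+1) col_sum A j.

Definition is_max (R : realType) (S : set R) (x : R) : Prop := S x /\ ubound S x.

Definition is_min (R : realType) (S : set R) (x : R) : Prop := S x /\ lbound S x.

(* Main.v *)
(** Any support matrix spreads the weight of each hyperedge over the vertices of
    its support, so the hyperedges of a subgraph H' together weigh at most
    s_max(A) times the weight of its vertices: every density is at most every
    s_max(A).  Conversely, let c be the maximal density.  A support matrix with all
    column sums at most c is a transport plan sending u_i from e_i to the vertices
    of its support, the vertex v_j having capacity c w_j, and maximality of c is
    exactly Hall's condition for this transport problem.  The fractional Hall
    theorem is proved by deleting the admissible pairs one at a time: before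
    deleting (i, j) one ships along it the least amount t that the remaining pairs
    cannot accommodate, and submodularity of the capacity of the neighbourhood
    shows that Hall's condition survives. *)
Require Import Defs.
From HB Require Import structures.
From mathcomp Require Import all_boot all_order all_algebra.
From mathcomp Require Import lra.
From mathcomp Require Import classical_sets reals.

Import Order.TTheory GRing.Theory Num.Theory.
Local Open Scope ring_scope.

Section FinsetSums.
Import boot.fintype boot.finset.
Set Implicit Arguments. Unset Strict Implicit.

Lemma sum_setUI (V : zmodType) (T : finType) (f : T -> V) (A B : {set T}) :
  \sum_(x in A :|: B) f x + \sum_(x in A :&: B) f x =
  \sum_(x in A) f x + \sum_(x in B) f x.
Proof.
rewrite [X in X + _ = _](big_setID B) [X in _ = X + _](big_setID B) /=.
rewrite setDUl setDv setU0 (setIidPr (subsetUr A B)).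
by rewrite addrAC [RHS]addrAC [X in _ = X + _]addrC [RHS]addrAC -!addrA [X in _ + X]addrC.
Qed.

Lemma sum_pred1 (V : zmodType) (T : finType) (P : pred T) (i : T) (t : V) :
  \sum_(k | P k) t *+ (k == i) = t *+ P i.
Proof.
have [Pi|nPi] := boolP (P i).
  by rewrite (bigD1 i) //= eqxx big1 ?addr0 // => k /andP[_ /negPf ->].
by rewrite big1 // => k Pk; case: eqP => // ki; rewrite -ki Pk in nPi.
Qed.

Lemma ler_sum_subset (R : numDomainType) (T : finType) (f : T -> R) (A B : {set T}) :
  (forall x, 0 <= f x) -> A \subset B ->
  \sum_(x in A) f x <= \sum_(x in B) f x.
Proof.
move=> f0 AB; rewrite [leRHS](big_setID A) /= (setIidPr AB) lerDl.
exact: sumr_ge0.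
Qed.

End FinsetSums.

Section FractionalHall.
Import boot.fintype boot.finset.
Set Implicit Arguments. Unset Strict Implicit.
Variables (R : realDomainType) (I J : finType).
Implicit Types (E : {set I * J}) (F G : {set I}) (u : I -> R) (d : J -> R).

Definition nbhd E F : {set J} := [set j | [exists i in F, (i, j) \in E]].

Lemma nbhdP E F j : reflect (exists2 i, i \in F & (i, j) \in E) (j \in nbhd E F).
Proof. by rewrite inE; exact: exists_inP. Qed.

Lemma nbhdS E E' F F' : E \subset E' -> F \subset F' -> nbhd E F \subset nbhd E' F'.
Proof.
move=> /subsetP EE' /subsetP FF'; apply/subsetP => j /nbhdP[i iF ij].
by apply/nbhdP; exists i; [exact: FF' | exact: EE'].
Qed.

(** Deleting [(i, j)] can cost [G] only the vertex [j], which [F] already reaches. Together with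
    [nbhd_delI] this gives submodularity with the pair deleted on the side of [G] alone. *)
Lemma nbhd_delU E i j F G : i \notin F -> j \in nbhd E F ->
  nbhd E (F :|: G) \subset nbhd E F :|: nbhd (E :\ (i, j)) G.
Proof.
move=> iF jF; apply/subsetP => l /nbhdP[k]; rewrite !in_setU => kFG kl.
case: (eqVneq l j) => [->|lj]; first by rewrite jF.
case/orP: kFG => kFG; apply/orP; [left|right]; apply/nbhdP; exists k => //.
by rewrite !inE kl andbT xpair_eqE negb_and lj orbT.
Qed.

Lemma nbhd_delI E i j F G : i \notin F ->
  nbhd E (F :&: G) \subset nbhd E F :&: nbhd (E :\ (i, j)) G.
Proof.
move=> iF; apply/subsetP => l /nbhdP[k]; rewrite !in_setI => /andP[kF kG] kl.
apply/andP; split; apply/nbhdP; exists k => //.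
rewrite !inE kl andbT xpair_eqE negb_and.
by case: eqP => // ki; rewrite -ki kF in iF.
Qed.

Lemma nbhd_del E i j F : (i \notin F) || (j \in nbhd (E :\ (i, j)) F) ->
  nbhd (E :\ (i, j)) F = nbhd E F.
Proof.
move=> h; apply/eqP; rewrite eqEsubset nbhdS ?subD1set //=.
apply/subsetP => l /nbhdP[k kF kl].
case: (eqVneq (k, l) (i, j)) => [[ki lj]|kl'].
  by move: h; rewrite -ki kF /= ki -lj.
by apply/nbhdP; exists k => //; rewrite !inE kl' kl.
Qed.

Lemma nbhd_delU1 E i j F : nbhd E F \subset j |: nbhd (E :\ (i, j)) F.
Proof.
apply/subsetP => l /nbhdP[k kF kl]; rewrite in_setU1.
case: eqVneq => //= lj; apply/nbhdP; exists k => //.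
by rewrite !inE kl andbT xpair_eqE negb_and lj orbT.
Qed.

Theorem fractional_hall E u d :
  (forall i, 0 <= u i) -> (forall j, 0 <= d j) ->
  (forall F, \sum_(i in F) u i <= \sum_(j in nbhd E F) d j) ->
  exists x : I -> J -> R,
    [/\ forall i j, 0 <= x i j,
        forall i j, (i, j) \notin E -> x i j = 0,
        forall i, \sum_j x i j = u i
      & forall j, \sum_i x i j <= d j].
Proof.
have [k] := ubnP #|E|.
elim: k => // k IHk in E u d *; rewrite ltnS => Ek u0 d0 hall.
have [E0|[[i j] ijE]] := set_0Vmem E.
  (* Without admissible pairs, Hall's condition on singletons forces [u] to vanish. *)
  exists (fun _ _ => 0); split=> // [i|j]; rewrite big1 //.
  apply/eqP; rewrite eq_le u0 /=.
  have := hall [set i]; rewrite big_set1 (_ : nbhd E [set i] = set0) ?big_set0 //.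
  by apply/setP => j; rewrite in_set0; apply/nbhdP => -[l _]; rewrite E0 in_set0.
pose E' := E :\ (i, j).
pose U (F : {set I}) := \sum_(i in F) u i; pose D (S : {set J}) := \sum_(j in S) d j.
have DS (S T : {set J}) : S \subset T -> D S <= D T by exact: ler_sum_subset.
(* The worst violation of Hall's condition after the deletion. Only sets containing [i] can lose
   neighbours, and the base value 0 covers the case of no violation. *)
pose t := \big[Num.max/0]_(F : {set I} | i \in F) (U F - D (nbhd E' F)).
have t0 : 0 <= t by exact: bigmax_ge_id.
have tge F : i \in F -> U F - D (nbhd E' F) <= t.
  by move=> iF; apply: (le_bigmax_cond 0 (fun F => U F - D (nbhd E' F))).
have tle c : 0 <= c -> (forall G, i \in G -> U G - D (nbhd E' G) <= c) -> t <= c.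
  by move=> c0 cG; apply: bigmax_le.
(* The deletion does not affect the neighbourhood of [G :\ i], so Hall's condition there leaves a
   deficit of at most [u i] for [G]. *)
have tu : t <= u i.
  apply: tle => // G iG.
  rewrite /U (big_setD1 i) //= -/(U _) lerBlDr lerD2l.
  apply: le_trans (hall _) _; apply: DS.
  rewrite -(@nbhd_del E i j) ?setD11 //.
  by apply: nbhdS => //; exact: subD1set.
have td : t <= d j.
  apply: tle => // G iG; rewrite lerBlDr; apply: le_trans (hall _) _.
  apply: le_trans (DS _ _ (nbhd_delU1 E i j G)) _.
  have := sum_setUI d [set j] (nbhd E' G); rewrite big_set1 => <-.
  by rewrite lerDl; exact: sumr_ge0.
(* Such an [F] keeps its whole supply while its neighbourhood loses capacity [t] at [j], so it needs
   slack [t]. *)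
have tF F : i \notin F -> j \in nbhd E F -> t <= D (nbhd E F) - U F.
  move=> iF jF; apply: tle => [|G iG]; first by rewrite subr_ge0; exact: hall.
  (* Uncrossing: Hall's condition at F :|: G and at F :&: G. *)
  have h1 := le_trans (hall _) (DS _ _ (nbhd_delU G iF jF)).
  have h2 := le_trans (hall _) (DS _ _ (nbhd_delI E j G iF)).
  have := sum_setUI u F G; have := sum_setUI d (nbhd E F) (nbhd E' G).
  rewrite -/(D _) -/(U _) in h1 h2 *; rewrite /E' /D /U in h1 h2 *.
  lra.
have [||||x [x0 xE xu xd]] :=
    IHk E' (fun k => u k - t *+ (k == i)) (fun l => d l - t *+ (l == j)).
- by move: Ek; rewrite (cardsD1 (i, j) E) ijE.
- by move=> l; case: eqP => [->|_]; rewrite ?mulr1n ?mulr0n ?subr0 ?subr_ge0.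
- by move=> l; case: eqP => [->|_]; rewrite ?mulr1n ?mulr0n ?subr0 ?subr_ge0.
- move=> F; rewrite !sumrB !sum_pred1 -/(U _) -/(D _).
  have hF := hall F; rewrite -/(U _) -/(D _) in hF.
  (* If [i] is outside [F], the slack [tF] pays for a loss at [j]. If [i] is in [F], either both
     sides drop by [t], or [j] is no longer reached and the choice of [t] suffices. *)
  have [iF|iF] := boolP (i \in F); last first.
    rewrite {1 2}/E' nbhd_del ?iF // subr0.
    have [jF|jF] := boolP (j \in nbhd E F); last by rewrite subr0.
    by have := tF _ iF jF; rewrite lerBrDr lerBrDl addrC.
  have [jF|jF] := boolP (j \in nbhd E' F).
    by rewrite lerD2r /E' nbhd_del // jF orbT.
  by rewrite subr0 lerBlDr -lerBlDl tge.
exists (fun k l => x k l + t *+ ((k == i) && (l == j))); split.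
- by move=> k' l; rewrite addr_ge0 // mulrn_wge0.
- move=> k' l kl; rewrite xE ?inE ?(negPf kl) ?andbF // add0r.
  by case: andP => // -[/eqP ki /eqP lj]; rewrite ki lj ijE in kl.
- move=> k'; rewrite big_split /= xu.
  by case: (k' == i) => /=; rewrite ?sum_pred1 ?big1_eq ?subrK ?subr0 ?addr0.
- move=> l; rewrite big_split /= -lerBrDr.
  under [X in _ - X]eq_bigr do rewrite andbC.
  apply: le_trans (xd l) _.
  by case: (l == j) => /=; rewrite ?sum_pred1 ?big1_eq ?subr0.
Qed.

End FractionalHall.

Lemma col_sum_le_s_max {R : realType} {m n : nat} (A : 'M[R]_(m, n.+1)) j :
  col_sum A j <= s_max A.
Proof. exact: le_bigmax. Qed.

Lemma wtV_gt0 {R : realType} {m n : nat} (H : hypergraph R m n) (V' : {set 'I_n}) :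
  V' != finset.set0 -> 0 < wtV H V'.
Proof.
move=> /finset.set0Pn[j jV]; rewrite /wtV (big_setD1 j) //=.
by rewrite ltr_pwDl ?vwt_gt0 // sumr_ge0 // => l _; exact/ltW/vwt_gt0.
Qed.

Lemma density_le_s_max {R : realType} {m n : nat} {H : hypergraph R m n.+1}
    (H' : subgraph H) (A : 'M[R]_(m, n.+1)) :
  sub_vertices H' != finset.set0 -> support_matrix H A -> density H' <= s_max A.
Proof.
case: H' => V' E' sE /= V0 [A0 As Au].
rewrite /density /= ler_pdivrMr ?wtV_gt0 // /wtE.
under eq_bigr do rewrite -Au.
have -> : \sum_(i in E') \sum_j vwt H j * A i j =
    \sum_(i in E') \sum_(j in V') vwt H j * A i j.
  apply: eq_bigr => i iE; rewrite [LHS](bigID (mem V')) /= [X in _ + X]big1 ?addr0 //.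
  by move=> j jV; rewrite As ?mulr0 //; apply: contra jV; apply/fintype.subsetP/sE.
rewrite exchange_big /= mulr_sumr ler_sum // => j _.
rewrite -mulr_sumr mulrC ler_pM2r ?vwt_gt0 //.
apply: le_trans (col_sum_le_s_max A j).
by rewrite /col_sum [leRHS](bigID (mem E')) /= lerDl sumr_ge0.
Qed.

Theorem theorem5 (R : realType) (m n : nat) (H : hypergraph R m n.+1)
  (Hcover : forall j : 'I_n.+1, exists i : 'I_m, j \in supp H i)
  (Hnonempty : forall i : 'I_m, supp H i != finset.set0) :
  exists c : R,
    is_max [set density H' | H' in
              [set H' : subgraph H | sub_vertices H' != finset.set0]]%classic c /\
    is_min [set s_max A | A in
              [set A : 'M[R]_(m, n.+1) | support_matrix H A]]%classic c.
Proof.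
pose P (p : {set 'I_n.+1} * {set 'I_m}) :=
  (p.1 != finset.set0) && [forall i in p.2, supp H i \subset p.1].
pose a (p : {set 'I_n.+1} * {set 'I_m}) := wtE H p.2 / wtV H p.1.
(* The edgeless subgraph on all vertices starts the search for a maximum; its density 0 also yields
   [0 <= c]. *)
have P0 : P (finset.setT, finset.set0).
  rewrite /P /=; apply/andP; split; first by apply/finset.set0Pn; exists ord0; rewrite inE.
  by apply/forall_inP => i; rewrite inE.
have [[V E] /andP[/= V0 /forall_inP sE] amax] := arg_maxP a P0.
pose G := @Subgraph R m n.+1 H V E sE.
set c := a (V, E) in amax.
have c0 : 0 <= c by have := amax _ P0; rewrite /a /= /wtE big_set0 mul0r.
have w0 j : 0 <= c * vwt H j by rewrite mulr_ge0 // ltW ?vwt_gt0.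
have [|x [x0 xE xu xd]] := @fractional_hall R _ _
    [set p | p.2 \in supp H p.1] (ewt H) _ (fun i => ltW (ewt_gt0 H i)) w0.
  move=> F; rewrite -mulr_sumr.
  have [->|/finset.set0Pn[i iF]] := eqVneq F finset.set0.
    by rewrite big_set0 mulr_ge0 // sumr_ge0 // => j _; rewrite ltW ?vwt_gt0.
  (* [(N, F)] is a subgraph, and the bound [c] on its density is Hall's condition for [F]. *)
  set N := nbhd _ _.
  have sN k : k \in F -> supp H k \subset N.
    by move=> kF; apply/fintype.subsetP => j jk; apply/nbhdP; exists k; rewrite ?inE.
  have N0 : N != finset.set0.
    have /finset.set0Pn[j ji] := Hnonempty i.
    by apply/finset.set0Pn; exists j; exact: (fintype.subsetP (sN i iF)).
  have /amax : P (N, F) by rewrite /P /= N0; exact/forall_inP.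
  by rewrite /a /= ler_pdivrMr ?wtV_gt0.
(* Dividing by the vertex weight turns shipped mass into matrix entries and the capacity
   [c * vwt H j] into the column bound [c]. *)
pose A := \matrix_(i, j) (x i j / vwt H j) : 'M[R]_(m, n.+1).
have SA : support_matrix H A.
  split=> [i j|i j ji|i].
  - by rewrite mxE divr_ge0 // ltW ?vwt_gt0.
  - by rewrite mxE xE ?mul0r // inE.
  - rewrite -xu; apply: eq_bigr => j _.
    by rewrite mxE mulrC divfK // gt_eqF ?vwt_gt0.
have GA : density G <= s_max A by exact: density_le_s_max.
have Ac : s_max A <= c.
  have Aj j : col_sum A j <= c.
    rewrite /col_sum; under eq_bigr do rewrite mxE.
    by rewrite -mulr_suml ler_pdivrMr ?vwt_gt0.
  by apply: bigmax_le.
exists c; split; split.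
- by exists G.
- by move=> _ [H' V'0 <-]; apply: le_trans Ac; exact: density_le_s_max.
- by exists A => //; apply/le_anti; rewrite Ac.
- by move=> _ [B SB <-]; rewrite (_ : c = density G) //; exact: density_le_s_max.
Qed.
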